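(* Let $\mathbb{V}$ be any variety of algebras, and suppose two algebras $A$ and $B$ in $\mathbb{V}$ are the directed colimits (in $\mathbb{V}$) of the sequences $(A_i,a_i)_{i\in\mathbb{N}}$ and $(B_k,b_k)_{k\in\mathbb{N}}$ of algebras and homomorphisms in $\mathbb{V}$, respectively. \begin{enumerate} \item Suppose that each $A_i$ and each $B_k$ is a finitely presented algebra. Then $A$ and $B$ are isomorphic if, and only if, the two sequences are confluent. \item Suppose that each $A_i$ and each $B_k$ is a finitely generated algebra, and that each $a_i$ and each $b_k$ is an injective homomorphism. Then $A$ and $B$ are isomorphic if, and only if, the two sequences are confluent. \end{enumerate}
   Context: $\mathbb{N}=\{1,2,3,\ldots\}$. A variety of algebras $\mathbb{V}$ is the class of all algebraic structures of a given type (in the usual universal-algebraic sense, with finitary operations) satisfying some set of equations, regarded as a category with the homomorphisms as morphisms. Varieties are closed under directed colimits. For an integer $n\geqslant 0$, $\mathscr{F}_n$ denotes the free algebra in $\mathbb{V}$ generated by a set of cardinality $n$. A congruence on an algebra $A$ is an equivalence relation on $A$ that is also a subalgebra of $A\times A$; it is finitely generated if it is the intersection of all congruences on $A$ containing some finite subset of $A\times A$. An algebra in $\mathbb{V}$ is finitely generated if it is isomorphic to a quotient of $\mathscr{F}_n$ for some integer $n\geqslant 0$; it is finitely presented if it is isomorphic to a quotient of $\mathscr{F}_n$ modulo some finitely generated congruence, for some integer $n\geqslant 0$. Sequences. A sequence $(A_i,a_i)_{i\in\mathbb{N}}$ in $\mathbb{V}$ consists of algebras $A_i$ and homomorphisms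 $a_i\colon A_i\to A_{i+1}$, $i\in\mathbb{N}$. For $i<j$ put $a_{ij}:=a_{j-1}\circ\cdots\circ a_{i+1}\circ a_i\colon A_i\to A_j$, and let $a_{ii}$ be the identity of $A_i$. The colimit of the sequence is the colimit of the directed diagram $(A_i,a_{ij})_{i,j\in\mathbb{N}}$. The same conventions apply to $(B_k,b_k)_{k\in\mathbb{N}}$, with $b_{kl}$. Confluence. The two sequences are confluent if there exist integers $0<i_1<i_2<\cdots$ and $0<k_1<k_2<\cdots$, together with homomorphisms $f_n\colon A_{i_n}\to B_{k_n}$ and $g_n\colon B_{k_n}\to A_{i_{n+1}}$ for each $n\in\mathbb{N}$, such that $a_{i_n i_{n+1}}=g_n\circ f_n$ and $b_{k_n k_{n+1}}=f_{n+1}\circ g_n$ for all $n\in\mathbb{N}$. *)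

(* Defs.v *)
From mathcomp Require Import all_boot.
From mathcomp Require Import boolp classical_sets functions cardinality.

Set Implicit Arguments.
Unset Strict Implicit.
Unset Printing Implicit Defensive.

Local Open Scope classical_set_scope.

Record signature : Type := Signature {
  symbol :> Type;
  arity : symbol -> nat }.

(* The carrier may be empty, so that the free algebra on zero generators
   exists even in the absence of constants. *)
Record algebra (Sigma : signature) : Type := Algebra {
  carrier :> Type;
  op : forall s : Sigma, ('I_(arity s) -> carrier) -> carrier }.
Arguments op {Sigma} a s _.

Record hom (Sigma : signature) (A B : algebra Sigma) : Type := Hom {
  hom_fun :> A -> B;
  homP : forall (s : Sigma) (x : 'I_(arity s) -> A),
    hom_fun (op A s x) = op B s (hom_fun \o x) }.

Definition id_hom (Sigma : signature) (A : algebra Sigma) : hom A A :=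
  @Hom Sigma A A id (fun s x => erefl).

Lemma comp_homP (Sigma : signature) (A B C : algebra Sigma)
    (g : hom B C) (f : hom A B) (s : Sigma) (x : 'I_(arity s) -> A) :
  (g \o f) (op A s x) = op C s ((g \o f) \o x).
Proof. by rewrite /= !homP. Qed.

Definition comp_hom (Sigma : signature) (A B C : algebra Sigma)
    (g : hom B C) (f : hom A B) : hom A C :=
  Hom (comp_homP g f).

Definition isomorphic (Sigma : signature) (A B : algebra Sigma) : Prop :=
  exists (f : hom A B) (g : hom B A), cancel f g /\ cancel g f.

Definition prod_algebra (Sigma : signature) (A B : algebra Sigma) :
    algebra Sigma :=
  @Algebra Sigma (A * B)%type (fun s x => (op A s (fst \o x), op B s (snd \o x))).

Definition subalgebra (Sigma : signature) (A : algebra Sigma) (S : set A) :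
    Prop :=
  forall (s : Sigma) (x : 'I_(arity s) -> A),
    (forall i, S (x i)) -> S (op A s x).

Record congruence (Sigma : signature) (A : algebra Sigma) : Type := Congruence {
  cong_set : set (A * A);
  cong_equiv : RelationClasses.Equivalence (fun x y => cong_set (x, y));
  cong_sub : @subalgebra Sigma (prod_algebra A A) cong_set }.

Definition fg_congruence (Sigma : signature) (A : algebra Sigma)
    (theta : congruence A) : Prop :=
  exists S : set (A * A), finite_set S /\
    cong_set theta =
      \bigcap_(phi in [set phi : congruence A | S `<=` cong_set phi])
        cong_set phi.

Section Quotient.
Variables (Sigma : signature) (A : algebra Sigma) (theta : congruence A).

Definition quotient_carrier : Type :=
  {C : set A | exists x, C = [set y | cong_set theta (x, y)]}.

Definition quotient_class (x : A) : quotient_carrier :=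
  exist _ [set y | cong_set theta (x, y)] (ex_intro _ x erefl).

Definition quotient_repr (C : quotient_carrier) : A := projT1 (cid (proj2_sig C)).

(* Independent of the chosen representatives, see quotient_homP. *)
Definition quotient : algebra Sigma :=
  @Algebra Sigma quotient_carrier
    (fun s x => quotient_class (op A s (quotient_repr \o x))).

Lemma quotient_classP (x y : A) :
  quotient_class x = quotient_class y <-> cong_set theta (x, y).
Proof.
have [r s t] := cong_equiv theta; split=> [/(congr1 (@proj1_sig _ _))/= e|xy].
  have : [set z | cong_set theta (y, z)] y by exact: r.
  by rewrite -e.
apply: eq_exist; apply/seteqP; split=> z /= h.
  exact: t (s _ _ xy) h.
exact: t xy h.
Qed.

Lemma quotient_reprK : cancel quotient_repr quotient_class.
Proof.
case=> C exC; rewrite /quotient_repr /=; case: cid => x /= e.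
by apply: eq_exist; rewrite e.
Qed.

Lemma quotient_homP (s : Sigma) (x : 'I_(arity s) -> A) :
  quotient_class (op A s x) = op quotient s (quotient_class \o x).
Proof.
apply/quotient_classP.
apply: (cong_sub (c := theta) (s := s)
  (x := fun i => (x i, quotient_repr (quotient_class (x i))))) => i.
by apply/quotient_classP; rewrite quotient_reprK.
Qed.

Definition quotient_hom : hom A quotient := @Hom Sigma A quotient _ quotient_homP.

End Quotient.

Inductive term (Sigma : signature) (X : Type) : Type :=
| Var of X
| App (s : Sigma) of ('I_(arity s) -> term Sigma X).
Arguments Var {Sigma X} _.
Arguments App {Sigma X} s _.

Definition term_algebra (Sigma : signature) (X : Type) : algebra Sigma :=
  @Algebra Sigma (term Sigma X) (fun s t => App s t).

Fixpoint eval (Sigma : signature) (X : Type) (A : algebra Sigma) (v : X -> A)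
    (t : term Sigma X) : A :=
  match t with
  | Var x => v x
  | App s ts => op A s (fun i => eval v (ts i))
  end.

Definition satisfies (Sigma : signature) (X : Type) (A : algebra Sigma)
    (e : term Sigma X * term Sigma X) : Prop :=
  forall v : X -> A, eval v e.1 = eval v e.2.

Definition variety (Sigma : signature) (V : algebra Sigma -> Prop) : Prop :=
  exists E : set (term Sigma nat * term Sigma nat),
    forall A : algebra Sigma, V A <-> (forall e, E e -> satisfies A e).

Section Free.
Variables (Sigma : signature) (V : algebra Sigma -> Prop) (X : Type).

Definition identities : set (term_algebra Sigma X * term_algebra Sigma X) :=
  [set e | forall A : algebra Sigma, V A -> satisfies A e].

Lemma identities_equiv :
  RelationClasses.Equivalence (fun s t => identities (s, t)).
Proof.
split=> [s A _ v //|s t st A VA v|s t u st tu A VA v] /=.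
  by rewrite (st A VA v).
by rewrite (st A VA v) (tu A VA v).
Qed.

Lemma identities_sub :
  @subalgebra Sigma
    (prod_algebra (term_algebra Sigma X) (term_algebra Sigma X)) identities.
Proof.
move=> s x hx A VA v /=; congr (op A s _); apply/funext => i.
exact: hx i A VA v.
Qed.

Definition identities_congruence : congruence (term_algebra Sigma X) :=
  Congruence identities_equiv identities_sub.

Definition free_on : algebra Sigma := quotient identities_congruence.

Definition free_gen (x : X) : free_on :=
  quotient_class identities_congruence (Var x).

End Free.

Definition free_algebra (Sigma : signature) (V : algebra Sigma -> Prop)
    (n : nat) : algebra Sigma :=
  free_on V 'I_n.

Definition finitely_generated (Sigma : signature) (V : algebra Sigma -> Prop)
    (A : algebra Sigma) : Prop :=
  exists (n : nat) (theta : congruence (free_algebra V n)),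
    isomorphic A (quotient theta).

Definition finitely_presented (Sigma : signature) (V : algebra Sigma -> Prop)
    (A : algebra Sigma) : Prop :=
  exists (n : nat) (theta : congruence (free_algebra V n)),
    fg_congruence theta /\ isomorphic A (quotient theta).

Section FreeUniversal.
Variables (Sigma : signature) (V : algebra Sigma -> Prop).

Lemma eval_hom (X : Type) (A B : algebra Sigma) (f : hom A B) (v : X -> A)
  (t : term Sigma X) : f (eval v t) = eval (f \o v) t.
Proof.
elim: t => [//|s ts ih] /=; rewrite homP; congr (op B s _).
by apply/funext => i /=.
Qed.

Fixpoint subst (X Y : Type) (sigma : X -> term Sigma Y) (t : term Sigma X) :
    term Sigma Y :=
  match t with
  | Var x => sigma x
  | App s ts => App s (fun i => subst sigma (ts i))
  end.

Lemma eval_subst (X Y : Type) (A : algebra Sigma) (sigma : X -> term Sigma Y)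
  (v : Y -> A) (t : term Sigma X) :
  eval v (subst sigma t) = eval (fun x => eval v (sigma x)) t.
Proof.
elim: t => [//|s ts ih] /=; congr (op A s _).
by apply/funext => i /=.
Qed.

Lemma eval_term (X Y : Type) (sigma : X -> term_algebra Sigma Y)
  (t : term Sigma X) : eval sigma t = subst sigma t.
Proof.
elim: t => [//|s ts ih] /=; congr (App s _).
by apply/funext => i /=.
Qed.

Lemma free_in_variety (X : Type) : variety V -> V (free_on V X).
Proof.
case=> E EV; apply/EV => e Ee v.
set q := quotient_hom (identities_congruence V X).
have -> : v = q \o (fun i => quotient_repr (v i)).
  by apply/funext => i; rewrite /= quotient_reprK.
rewrite -!eval_hom !eval_term; apply/quotient_classP => A VA w.
by rewrite /= !eval_subst; apply: (EV A).1 => //.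
Qed.

Theorem free_universal (X : Type) (A : algebra Sigma) (v : X -> A) : V A ->
  exists f : hom (free_on V X) A,
    f \o @free_gen Sigma V X =1 v /\
    forall g : hom (free_on V X) A, g \o @free_gen Sigma V X =1 v -> g =1 f.
Proof.
move=> VA; set q := quotient_hom (identities_congruence V X).
have evq s t : q s = q t -> eval v s = eval v t.
  by move/quotient_classP => /(_ A VA v).
pose f (C : free_on V X) := eval v (quotient_repr C).
have fq t : f (q t) = eval v t by apply: evq; exact: quotient_reprK.
have fP s x : f (op (free_on V X) s x) = op A s (f \o x) by exact: fq.
exists (Hom fP); split=> [x|g gv C] /=; first exact: fq.
have -> : C = q (quotient_repr C) by rewrite /= quotient_reprK.
rewrite -[RHS]/(f (q _)) fq.
elim: (quotient_repr C) => [x|s ts ih]; first exact: gv.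
have eq_q : q (App s ts) = op (free_on V X) s (q \o ts) by exact: (homP q).
rewrite eq_q homP /=; congr (op A s _); apply/funext => i; exact: ih.
Qed.

End FreeUniversal.

(* Indices start at 0: [seq_alg S i] is the (i+1)-st algebra of the sequence,
   so a requirement [0 < i] on 1-based indices is vacuous here. *)
Record sequence (Sigma : signature) : Type := Sequence {
  seq_alg :> nat -> algebra Sigma;
  seq_hom : forall i : nat, hom (seq_alg i) (seq_alg i.+1) }.

Section Transition.
Variables (Sigma : signature) (S : sequence Sigma).

Fixpoint seq_iter (i d : nat) : hom (S i) (S (d + i)) :=
  match d with
  | 0 => id_hom (S i)
  | d'.+1 => comp_hom (seq_hom S (d' + i)) (seq_iter i d')
  end.

Definition seq_trans (i j : nat) (le_ij : i <= j) : hom (S i) (S j) :=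
  eq_rect (j - i + i) (fun k => hom (S i) (S k)) (seq_iter i (j - i)) j
    (subnK le_ij).

Lemma seq_trans_refl (i : nat) (h : i <= i) : seq_trans h =1 id.
Proof.
move=> x; rewrite /seq_trans; move: (subnK h); rewrite subnn => e.
by rewrite (eq_irrelevance e erefl).
Qed.

Lemma seq_trans_step (i j : nat) (h : i <= j) (h' : i <= j.+1) :
  seq_trans h' =1 seq_hom S j \o seq_trans h.
Proof.
move=> x; rewrite /seq_trans; move: (subnK h) (subnK h'); rewrite subSn //.
move: (j - i) => d e; case: j / e h h' => _ _ e.
by rewrite (eq_irrelevance e erefl).
Qed.

Definition is_cocone (C : algebra Sigma) (c : forall i, hom (S i) C) : Prop :=
  forall (i j : nat) (le_ij : i <= j), c j \o seq_trans le_ij =1 c i.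

Definition is_colimit (V : algebra Sigma -> Prop) (A : algebra Sigma) : Prop :=
  V A /\ exists alpha : forall i, hom (S i) A,
    is_cocone alpha /\
    forall (C : algebra Sigma) (c : forall i, hom (S i) C),
      V C -> is_cocone c ->
      exists h : hom A C, (forall i, h \o alpha i =1 c i) /\
        forall h' : hom A C, (forall i, h' \o alpha i =1 c i) -> h' =1 h.

End Transition.

Definition confluent (Sigma : signature) (SA SB : sequence Sigma) : Prop :=
  exists (i k : nat -> nat)
         (lt_i : forall n, i n < i n.+1) (lt_k : forall n, k n < k n.+1)
         (f : forall n, hom (SA (i n)) (SB (k n)))
         (g : forall n, hom (SB (k n)) (SA (i n.+1))),
    forall n,
      seq_trans SA (ltnW (lt_i n)) =1 g n \o f n /\
      seq_trans SB (ltnW (lt_k n)) =1 f n.+1 \o g n.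

(* Main.v *)
(** Directed colimits of algebras are computed on underlying sets: every element
    of the colimit comes from some stage, and two elements of a stage with the
    same image already agree at a later stage.  Hence a homomorphism from a
    finitely presented algebra to the colimit factors through some stage (lift
    the finitely many generators, then go far enough for the finitely many
    relations to hold), and two factorizations through the same stage agree
    later on.  When the transition maps are injective so are the maps to the
    colimit, the relations hold for free, and finite generation suffices.  Given
    an isomorphism of the colimits, factoring alternately through both sequences
    builds the two interleaved families of homomorphisms. *)
Require Import Defs.
From mathcomp Require Import all_boot.
From mathcomp Require Import boolp classical_sets functions cardinality.

Set Implicit Arguments.
Unset Strict Implicit.
Unset Printing Implicit Defensive.

(** * Uniform bounds for finitely many eventual conditions *)

Lemma eventually_ord (n : nat) (Q : 'I_n -> nat -> Prop) :
  (forall x, exists N, forall m, N <= m -> Q x m) ->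
  exists N, forall x m, N <= m -> Q x m.
Proof.
move=> /choice[N NQ]; exists (\max_x N x) => x m le_m.
by apply: NQ; apply: leq_trans le_m; exact: leq_bigmax.
Qed.

Lemma eventually_finite (T : Type) (D : set T) (Q : T -> nat -> Prop) :
  finite_set D ->
  (forall x, D x -> exists N, forall m, N <= m -> Q x m) ->
  exists N, forall x, D x -> forall m, N <= m -> Q x m.
Proof.
case=> n /card_set_bijP[f [fD f_inj _]] NQ.
have [|N hN] := @eventually_ord n (fun a m => forall x, D x -> f x = a -> Q x m).
  move=> a; have [[x [Dx fx]]|no] := pselect (exists x, D x /\ f x = a).
    have [N hN] := NQ x Dx; exists N => m le_m y Dy fy.
    rewrite (_ : y = x); first exact: hN.
    by apply: f_inj; rewrite ?inE // fx fy.
  by exists 0 => m _ x Dx fx; case: no; exists x.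
exists N => x Dx m le_m.
exact: (hN (Ordinal (fD x Dx)) m le_m x Dx).
Qed.

(** * Composition and injectivity of transition maps *)

(** The argument [hik] is kept separate so that the equation rewrites with any proof of [i <= k]. *)
Lemma seq_trans_comp (Sigma : signature) (S : sequence Sigma) (i j k : nat)
    (hij : i <= j) (hjk : j <= k) (hik : i <= k) (x : S i) :
  seq_trans S hjk (seq_trans S hij x) = seq_trans S hik x.
Proof.
elim: k => [|k ih] in hjk hik *.
  have j0 : j = 0 by apply/eqP; rewrite -leqn0.
  subst j; rewrite seq_trans_refl.
  by rewrite (bool_irrelevance hij hik).
have: j <= k.+1 := hjk; rewrite leq_eqVlt ltnS => /orP[/eqP e|hjk'].
  by subst j; rewrite seq_trans_refl (bool_irrelevance hij hik).
have hik' : i <= k by exact: leq_trans hij hjk'.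
by rewrite (seq_trans_step hjk') (seq_trans_step hik') /= ih.
Qed.

Lemma seq_trans_inj (Sigma : signature) (S : sequence Sigma) :
  (forall i, injective (seq_hom S i)) ->
  forall i j (h : i <= j), injective (seq_trans S h).
Proof.
move=> S_inj i; elim=> [|j ih] h x y.
  have i0 : i = 0 by apply/eqP; rewrite -leqn0.
  by subst i; rewrite !seq_trans_refl.
have: i <= j.+1 := h; rewrite leq_eqVlt ltnS => /orP[/eqP e|h'].
  by subst i; rewrite !seq_trans_refl.
by rewrite !(seq_trans_step h') /= => /S_inj /ih.
Qed.

(** * The directed colimit built on underlying sets *)

Section SetColimit.
Variables (Sigma : signature) (S : sequence Sigma).

(** Asking for agreement at all late stages lets bounds be merged by maxima; [eventually_equal_at]
    derives it from a single stage. *)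
Definition eventually_equal (i j : nat) (x : S i) (y : S j) : Prop :=
  exists N, forall m (hi : i <= m) (hj : j <= m), N <= m ->
    seq_trans S hi x = seq_trans S hj y.

Lemma eventually_equal_at (i j m : nat) (hi : i <= m) (hj : j <= m)
    (x : S i) (y : S j) :
  seq_trans S hi x = seq_trans S hj y -> eventually_equal x y.
Proof.
move=> e; exists m => k hi' hj' le_mk.
by rewrite -(seq_trans_comp hi le_mk) e (seq_trans_comp hj le_mk).
Qed.

Lemma eventually_equal_sym (i j : nat) (x : S i) (y : S j) :
  eventually_equal x y -> eventually_equal y x.
Proof. by case=> N e; exists N => m hj hi le_m; rewrite (e m hi hj). Qed.

Lemma eventually_equal_trans (i j k : nat) (x : S i) (y : S j) (z : S k) :
  eventually_equal x y -> eventually_equal y z -> eventually_equal x z.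
Proof.
case=> N e [M e']; pose m := maxn (maxn N M) (maxn i (maxn j k)).
have [hN hM hi hj hk] : [/\ N <= m, M <= m, i <= m, j <= m & k <= m].
  by rewrite /m !leq_max !leqnn ?orbT.
by apply: (eventually_equal_at (hi := hi) (hj := hk)); rewrite (e m hi hj) // e'.
Qed.

(** The disjoint union of the stages modulo eventual equality; classes are sets, so that equality of
    classes is Leibniz equality. *)
Definition colim_carrier : Type :=
  {C : set {i & S i} |
    exists i (x : S i), C = [set p | eventually_equal x (tagged p)]%classic}.

Definition colim_class (i : nat) (x : S i) : colim_carrier :=
  exist _ [set p | eventually_equal x (tagged p)]%classic
    (ex_intro _ i (ex_intro _ x erefl)).

Lemma colim_classP (i j : nat) (x : S i) (y : S j) :
  colim_class x = colim_class y <-> eventually_equal x y.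
Proof.
split=> [/(congr1 (@proj1_sig _ _))/= e|xy].
  have : [set p | eventually_equal y (tagged p)]%classic (existT (fun i => S i : Type) j y).
    by exists 0 => m hj hj' _; rewrite (bool_irrelevance hj hj').
  by rewrite -e.
apply: eq_exist; apply/seteqP; split=> p /= h.
  exact: eventually_equal_trans (eventually_equal_sym xy) h.
exact: eventually_equal_trans xy h.
Qed.

Lemma colim_class_trans (i j : nat) (h : i <= j) (x : S i) :
  colim_class (seq_trans S h x) = colim_class x.
Proof.
apply/colim_classP; apply: (eventually_equal_at (hi := leqnn j) (hj := h)).
exact: seq_trans_refl.
Qed.

Lemma colim_class_surj (C : colim_carrier) :
  exists N, forall m, N <= m -> exists x : S m, colim_class x = C.
Proof.
case: C => C exC; have [i [x e]] := exC; exists i => m h.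
exists (seq_trans S h x); rewrite colim_class_trans.
by apply: eq_exist; rewrite e.
Qed.

Lemma colim_lift (n : nat) (v : 'I_n -> colim_carrier) :
  exists N, forall m, N <= m ->
    exists w : 'I_n -> S m, forall x, colim_class (w x) = v x.
Proof.
have [N hN] := eventually_ord (fun x => colim_class_surj (v x)).
by exists N => m le_m; have /choice[w wv] := fun x => hN x m le_m; exists w.
Qed.

Lemma colim_lift_ex (n : nat) (v : 'I_n -> colim_carrier) :
  exists p : {m & 'I_n -> S m}, forall x, colim_class (tagged p x) = v x.
Proof.
have [N hN] := colim_lift v; have [w wv] := hN N (leqnn N).
by exists (existT (fun m => 'I_n -> S m) N w).
Qed.

(** Arities are finite, so the arguments lift to one stage, where the operation is performed;
    [colim_homP] gives independence of the choices. *)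
Definition colim_algebra : algebra Sigma :=
  @Algebra Sigma colim_carrier (fun s v =>
    let p := projT1 (cid (colim_lift_ex v)) in
    colim_class (op (S (tag p)) s (tagged p))).

Lemma colim_homP (i : nat) (s : Sigma) (x : 'I_(arity s) -> S i) :
  colim_class (op (S i) s x) = op colim_algebra s (@colim_class i \o x).
Proof.
rewrite /=; case: cid => -[k y] /= yx; apply/esym/colim_classP.
have ev a : exists N, forall m, N <= m -> forall (hk : k <= m) (hi : i <= m),
    seq_trans S hk (y a) = seq_trans S hi (x a).
  have /colim_classP[N hN] := yx a.
  by exists N => m le_m hk hi; exact: hN.
have [N hN] := eventually_ord ev.
pose m := maxn N (maxn k i).
have [le_N hk hi] : [/\ N <= m, k <= m & i <= m].
  by rewrite /m !leq_max !leqnn ?orbT.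
apply: (eventually_equal_at (hi := hk) (hj := hi)).
rewrite !homP; congr (op _ s _); apply/funext => a /=.
exact: hN.
Qed.

Definition colim_hom (i : nat) : hom (S i) colim_algebra :=
  @Hom Sigma (S i) colim_algebra (@colim_class i) (@colim_homP i).

(** Finitary terms contain finitely many variables. This bridges equations over [nat] and
    [colim_lift], which lifts finite families. *)
Lemma eval_finite_support (A : algebra Sigma) (t : term Sigma nat) :
  exists N, forall m, N <= m -> forall v w : nat -> A,
    (forall n, n < m -> v n = w n) -> eval v t = eval w t.
Proof.
elim: t => [n|s ts ih].
  by exists n.+1 => m lt_m v w; exact.
have [N hN] := eventually_ord ih.
exists N => m le_m v w vw /=; congr (op A s _); apply/funext => i.
exact: hN i m le_m v w vw.
Qed.

Lemma colim_in_variety (V : algebra Sigma -> Prop) :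
  variety V -> (forall i, V (S i)) -> V colim_algebra.
Proof.
case=> E EV SV; apply/EV => e Ee v.
have [N1 h1] := eval_finite_support colim_algebra e.1.
have [N2 h2] := eval_finite_support colim_algebra e.2.
pose N := maxn N1 N2.
(* [N.+1] rather than [N]: stages may be empty, and the lift of [v 0] (the junk
   value of [inord]) serves as the value of the variables beyond [N]. *)
have [M hM] := @colim_lift N.+1 (fun x => v x).
have [w wv] := hM M (leqnn M).
pose u n := w (inord n).
have uv n : n < N -> (colim_hom M \o u) n = v n.
  by move=> lt_n; rewrite /= wv inordK // ltnS ltnW.
rewrite -(h1 N (leq_maxl _ _) _ _ uv) -(h2 N (leq_maxr _ _) _ _ uv).
rewrite -!eval_hom; congr (colim_hom M _).
exact: (EV (S M)).1 (SV M) e Ee u.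
Qed.

Lemma cocone_colim_hom : @is_cocone Sigma S colim_algebra colim_hom.
Proof. by move=> i j h x; exact: colim_class_trans. Qed.

Lemma colim_hom_ex (C : algebra Sigma) (c : forall i, hom (S i) C) :
  is_cocone c ->
  exists h : hom colim_algebra C, forall i, h \o colim_hom i =1 c i.
Proof.
move=> c_cocone.
have ev_c i j (x : S i) (y : S j) : eventually_equal x y -> c i x = c j y.
  case=> N e; pose m := maxn N (maxn i j).
  have [le_N hi hj] : [/\ N <= m, i <= m & j <= m].
    by rewrite /m !leq_max !leqnn ?orbT.
  by rewrite -(c_cocone i m hi) -(c_cocone j m hj) /= (e m hi hj).
(* A cocone is constant on each class, and [h] takes that common value. *)
have /choice[h hc] (q : colim_algebra) :
    exists y, forall i (x : S i), colim_class x = q -> c i x = y.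
  have [N hN] := colim_class_surj q; have [x xq] := hN N (leqnn N).
  exists (c N x) => i y yq; apply: ev_c; apply/colim_classP.
  by rewrite yq xq.
have hP s x : h (op colim_algebra s x) = op C s (h \o x).
  have [N hN] := colim_lift x; have [w wx] := hN N (leqnn N).
  have -> : x = colim_hom N \o w by apply/funext => a; rewrite /= wx.
  rewrite -homP -(hc _ N _ erefl) homP; congr (op C s _).
  by apply/funext => a /=; exact: hc.
by exists (Hom hP) => i x /=; rewrite -(hc _ i x erefl).
Qed.

End SetColimit.

(** * Transfer to an arbitrary colimit *)

Definition jointly_surjective (Sigma : signature) (S : sequence Sigma)
    (A : algebra Sigma) (alpha : forall i, hom (S i) A) : Prop :=
  forall a, exists N, forall m, N <= m -> exists x, alpha m x = a.

Definition eventually_injective (Sigma : signature) (S : sequence Sigma)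
    (A : algebra Sigma) (alpha : forall i, hom (S i) A) : Prop :=
  forall i (x y : S i), alpha i x = alpha i y -> eventually_equal x y.

(** The concrete colimit lies in the variety, so the universal property maps [A] to it by some [h].
    Eventual injectivity pulls back along [h]; surjectivity is pushed along a map [k] in the other
    direction. *)
Lemma colimit_concrete (Sigma : signature) (S : sequence Sigma)
    (V : algebra Sigma -> Prop) (A : algebra Sigma)
    (alpha : forall i, hom (S i) A) :
  variety V -> (forall i, V (S i)) -> V A -> is_cocone alpha ->
  (forall (C : algebra Sigma) (c : forall i, hom (S i) C), V C -> is_cocone c ->
    exists h : hom A C, (forall i, h \o alpha i =1 c i) /\
      forall h' : hom A C, (forall i, h' \o alpha i =1 c i) -> h' =1 h) ->
  jointly_surjective alpha /\ eventually_injective alpha.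
Proof.
move=> Vv SV VA alphaC alphaU.
have [h [ha _]] := alphaU _ _ (colim_in_variety Vv SV) (@cocone_colim_hom _ S).
have [k ka] := colim_hom_ex alphaC.
split=> [a|i x y e]; last first.
  by apply/colim_classP; rewrite -[LHS]ha -[RHS]ha /= e.
have [j [_ jU]] := alphaU _ _ VA alphaC.
(* Both [k \o h] and the identity commute with [alpha], so uniqueness identifies them. *)
have kh : k (h a) = a.
  have := jU (comp_hom k h) _ a; rewrite /= => ->.
    by rewrite -(jU (id_hom A)).
  by move=> i x /=; have /= -> := ha i x; exact: ka.
have [N hN] := colim_class_surj (h a).
exists N => m le_m; have [x xa] := hN m le_m; exists x.
by rewrite -kh -xa; apply/esym; exact: ka.
Qed.

(** * Covers by free algebras *)

Section FiniteGeneration.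
Variables (Sigma : signature) (V : algebra Sigma -> Prop).

Lemma finitely_generated_cover (P : algebra Sigma) :
  finitely_generated V P ->
  exists n (e : hom (free_algebra V n) P), forall p, exists x, e x = p.
Proof.
case=> n [theta [f [g [fK gK]]]].
exists n, (comp_hom g (quotient_hom theta)) => p.
by exists (quotient_repr (f p)); rewrite /= quotient_reprK.
Qed.

(** The kernel of [e] is [theta]. If [u] respects [R], its kernel is a congruence containing [R],
    hence contains [theta]. *)
Lemma finitely_presented_cover (P : algebra Sigma) :
  finitely_presented V P ->
  exists n (e : hom (free_algebra V n) P),
    (forall p, exists x, e x = p) /\
    exists R : set (free_algebra V n * free_algebra V n),
      [/\ finite_set R, (forall r, R r -> e r.1 = e r.2) &
        forall (C : algebra Sigma) (u : hom (free_algebra V n) C),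
          (forall r, R r -> u r.1 = u r.2) ->
          forall x y, e x = e y -> u x = u y].
Proof.
case=> n [theta [[R [finR thetaR]] [f [g [fK gK]]]]].
have eP x y : comp_hom g (quotient_hom theta) x =
    comp_hom g (quotient_hom theta) y <-> cong_set theta (x, y).
  by rewrite /= -quotient_classP; split=> [/(can_inj gK)|->].
exists n, (comp_hom g (quotient_hom theta)); split=> [p|].
  by exists (quotient_repr (f p)); rewrite /= quotient_reprK.
exists R; split=> // [[x y] Rxy|C u uR x y /eP].
  by apply/eP; rewrite thetaR => phi; exact.
have ker_equiv : RelationClasses.Equivalence
    (fun x y => [set r | u r.1 = u r.2]%classic (x, y)).
  by split=> [a|a b|a b c] //= -> .
have ker_sub : @subalgebra Sigma (prod_algebra _ _) [set r | u r.1 = u r.2]%classic.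
  move=> s a ha /=; rewrite !homP; congr (op C s _).
  by apply/funext => i; exact: ha.
rewrite thetaR => /(_ (Congruence ker_equiv ker_sub)) /=; apply => r; exact: uR.
Qed.

(** Compose [u] with a set-theoretic section of [e]; the kernel condition makes the composite a
    homomorphism. *)
Lemma factor_surj (F P C : algebra Sigma) (e : hom F P) (u : hom F C) :
  (forall p, exists x, e x = p) -> (forall x y, e x = e y -> u x = u y) ->
  exists g : hom P C, g \o e =1 u.
Proof.
move=> /choice[r rK] eu.
have gP s x : (u \o r) (op P s x) = op C s ((u \o r) \o x).
  rewrite -[RHS](homP u (r \o x)) /=; apply: eu; rewrite rK homP.
  by congr (op P s _); apply/funext => i /=; rewrite rK.
by exists (Hom gP) => x /=; apply: eu.
Qed.

Lemma free_hom_ext (X : Type) (C : algebra Sigma) (u w : hom (free_on V X) C) :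
  V C -> u \o free_gen V (X := X) =1 w \o free_gen V (X := X) -> u =1 w.
Proof.
move=> VC uw; have [h [_ hU]] := free_universal (w \o free_gen V (X := X)) VC.
by move=> x; rewrite (hU u uw) (hU w (fun=> erefl)).
Qed.

End FiniteGeneration.

(** * Homomorphisms into a colimit and its stages *)

Section Factorization.
Variables (Sigma : signature) (V : algebra Sigma -> Prop).
Variables (S : sequence Sigma) (A : algebra Sigma) (alpha : forall i, hom (S i) A).
Hypotheses (SV : forall i, V (S i)) (VA : V A) (alphaC : is_cocone alpha).
Hypotheses (alphaS : jointly_surjective alpha) (alphaI : eventually_injective alpha).

(** This property and [factors_uniquely] are surjectivity and injectivity of the canonical map from
    the colimit of the sets Hom([P], [S m]) to Hom([P], [A]). *)
Definition factors_eventually (P : algebra Sigma) : Prop :=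
  forall f : hom P A, exists N, forall m, N <= m ->
    exists g : hom P (S m), alpha m \o g =1 f.

Definition factors_uniquely (P : algebra Sigma) : Prop :=
  forall i (g g' : hom P (S i)), alpha i \o g =1 alpha i \o g' ->
    exists N, forall m (h : i <= m), N <= m ->
      seq_trans S h \o g =1 seq_trans S h \o g'.

Lemma fg_factors_uniquely (P : algebra Sigma) :
  finitely_generated V P -> factors_uniquely P.
Proof.
move=> /finitely_generated_cover[n [e e_surj]] i g g' gg'.
have ev (x : 'I_n) : exists N, forall m, N <= m -> forall h : i <= m,
    seq_trans S h (g (e (free_gen V x))) = seq_trans S h (g' (e (free_gen V x))).
  have [N hN] := alphaI (gg' (e (free_gen V x))).
  by exists N => m le_m h; exact: hN.
have [N hN] := eventually_ord ev.
exists N => m h le_m p; have [x <-] := e_surj p.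
apply: (free_hom_ext (u := comp_hom (seq_trans S h) (comp_hom g e))
  (w := comp_hom (seq_trans S h) (comp_hom g' e)) (SV m)) => y.
exact: hN.
Qed.

Lemma free_factors (n : nat) : factors_eventually (free_algebra V n).
Proof.
move=> f; have [N hN] := eventually_ord (fun x => alphaS (f (free_gen V x))).
exists N => m le_m.
have /choice[v vf] : forall x, exists y, alpha m y = f (free_gen V x).
  by move=> x; exact: hN.
have [u [uv _]] := free_universal v (SV m); exists u.
apply: (free_hom_ext (u := comp_hom (alpha m) u) VA) => x /=.
by have /= -> := uv x.
Qed.

Lemma fp_factors_eventually (P : algebra Sigma) :
  finitely_presented V P -> factors_eventually P.
Proof.
move=> /finitely_presented_cover[n [e [e_surj [R [finR Re eR]]]]] f.
have [N hN] := free_factors (comp_hom f e); have [u uf] := hN N (leqnn N).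
(* The relations hold in [A] because [f] is defined on [P]; eventual injectivity makes each hold at
   late stages. *)
have ev r : R r -> exists M, forall m, M <= m -> forall h : N <= m,
    seq_trans S h (u r.1) = seq_trans S h (u r.2).
  move=> Rr; have [|M hM] := alphaI (x := u r.1) (y := u r.2).
    by have /= -> := uf r.1; have /= -> := uf r.2; rewrite Re.
  by exists M => m le_m h; exact: hM.
have [M hM] := eventually_finite finR ev.
exists (maxn N M) => m; rewrite geq_max => /andP[hNm hMm].
have [|g ge] := factor_surj (e := e) (u := comp_hom (seq_trans S hNm) u) e_surj.
  by apply: eR => r Rr; exact: hM.
exists g => p; have [x <-] := e_surj p.
have /= -> := ge x; have /= -> := alphaC hNm (u x); exact: uf.
Qed.

Lemma fg_factors_eventually (P : algebra Sigma) :
  (forall i, injective (seq_hom S i)) ->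
  finitely_generated V P -> factors_eventually P.
Proof.
move=> S_inj /finitely_generated_cover[n [e e_surj]] f.
(* Elements with equal images agree at a later stage, hence already at stage [i]. The lift of
   [f \o e] then respects the whole kernel of [e], with no finiteness of relations. *)
have alpha_inj i : injective (alpha i).
  move=> x y /alphaI[N hN]; have h : i <= maxn N i by exact: leq_maxr.
  exact: seq_trans_inj S_inj _ _ h _ _ (hN _ h h (leq_maxl _ _)).
have [N hN] := free_factors (comp_hom f e).
exists N => m le_m; have [u uf] := hN m le_m.
have [x y exy|g ge] := factor_surj (e := e) (u := u) e_surj.
  by apply: alpha_inj; have /= -> := uf x; have /= -> := uf y; rewrite exy.
exists g => p; have [x <-] := e_surj p.
by have /= -> := ge x; exact: uf.
Qed.

End Factorization.

(** * Back-and-forth construction of confluence *)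

(** Factor [psi \o beta k] as [alpha j \o g]. Then [g \o f] and the transition map agree after
    [alpha j], hence at a later stage [m], to which [g] is pushed. *)
Lemma back_step (Sigma : signature) (SA SB : sequence Sigma) (A B : algebra Sigma)
    (alpha : forall i, hom (SA i) A) (beta : forall k, hom (SB k) B)
    (phi : hom A B) (psi : hom B A) (i k : nat) (f : hom (SA i) (SB k)) :
  is_cocone alpha -> cancel phi psi ->
  factors_uniquely alpha (SA i) -> factors_eventually alpha (SB k) ->
  beta k \o f =1 phi \o alpha i ->
  exists i' (h : i < i') (g : hom (SB k) (SA i')),
    alpha i' \o g =1 psi \o beta k /\ seq_trans SA (ltnW h) =1 g \o f.
Proof.
move=> alphaC phiK uniqA exB fphi.
have [N hN] := exB (comp_hom psi (beta k)).
(* The bound [i.+1] makes the new index strictly larger. *)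
pose j := maxn N i.+1; have lt_j : i < j by exact: leq_maxr.
have [g ge] := hN j (leq_maxl _ _).
have [|M hM] := uniqA j (comp_hom g f) (seq_trans SA (ltnW lt_j)).
  move=> x; have /= -> := ge (f x); have /= -> := fphi x.
  by rewrite phiK; have /= -> := alphaC _ _ (ltnW lt_j) x.
pose m := maxn M j; have hj : j <= m by exact: leq_maxr.
have lt_m : i < m by exact: leq_trans lt_j hj.
exists m, lt_m, (comp_hom (seq_trans SA hj) g); split=> x /=.
  by have /= -> := alphaC _ _ hj (g x); exact: ge.
have /= -> := hM m hj (leq_maxl _ _) x.
by rewrite (seq_trans_comp _ _ (ltnW lt_m)).
Qed.

Section BackAndForth.
Variables (Sigma : signature) (SA SB : sequence Sigma) (A B : algebra Sigma).
Variables (alpha : forall i, hom (SA i) A) (beta : forall k, hom (SB k) B).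
Variables (phi : hom A B) (psi : hom B A).
Hypotheses (alphaC : is_cocone alpha) (betaC : is_cocone beta).
Hypotheses (phiK : cancel phi psi) (psiK : cancel psi phi).
Hypotheses (uniqA : forall i, factors_uniquely alpha (SA i)).
Hypotheses (uniqB : forall k, factors_uniquely beta (SB k)).
Hypotheses (exA : forall i, factors_eventually beta (SA i)).
Hypotheses (exB : forall k, factors_eventually alpha (SB k)).

(** The state of the recursion: [match_compat] is the invariant that [back_step] consumes and,
    applied twice, restores. *)
Record partial_match : Type := PartialMatch {
  match_i : nat;
  match_k : nat;
  match_hom : hom (SA match_i) (SB match_k);
  match_compat : beta match_k \o match_hom =1 phi \o alpha match_i }.

(** The second use of [back_step] exchanges the two sequences and starts from [g]. *)
Lemma match_next (p : partial_match) :
  exists (q : partial_match) (hi : match_i p < match_i q)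
      (hk : match_k p < match_k q) (g : hom (SB (match_k p)) (SA (match_i q))),
    seq_trans SA (ltnW hi) =1 g \o match_hom p /\
    seq_trans SB (ltnW hk) =1 match_hom q \o g.
Proof.
case: p => i k f fphi /=.
have [i' [hi [g [gpsi gf]]]] := back_step alphaC phiK (@uniqA i) (@exB k) fphi.
have [k' [hk [f' [fphi' fg]]]] :=
  back_step betaC psiK (@uniqB k) (@exA i') gpsi.
by exists (PartialMatch fphi'), hi, hk, g.
Qed.

Lemma back_and_forth : confluent SA SB.
Proof.
have [N hN] := exA (comp_hom phi (alpha 0)).
have [f0 f0phi] := hN N (leqnn N).
have [next nextP] := choice match_next.
pose st n := iter n next (@PartialMatch 0 N f0 f0phi).
exists (fun n => match_i (st n)), (fun n => match_k (st n)).
have lt_i n : match_i (st n) < match_i (st n.+1) by have [] := nextP (st n).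
have lt_k n : match_k (st n) < match_k (st n.+1) by have [? []] := nextP (st n).
exists lt_i, lt_k, (fun n => match_hom (st n)).
(* The backward maps are not stored in the states; they are recovered from the relation between
   successive states. *)
have gP n : exists g : hom (SB (match_k (st n))) (SA (match_i (st n.+1))),
    seq_trans SA (ltnW (lt_i n)) =1 g \o match_hom (st n) /\
    seq_trans SB (ltnW (lt_k n)) =1 match_hom (st n.+1) \o g.
  have [hi [hk [g gP]]] := nextP (st n); exists g.
  by rewrite (bool_irrelevance (lt_i n) hi) (bool_irrelevance (lt_k n) hk).
by exists (fun n => projT1 (cid (gP n))) => n; case: cid.
Qed.

End BackAndForth.

(** * Isomorphism from confluence *)

(** Since [j <= i j], a cocone on the subsequence extends to all stages: go from stage [j] to stage
    [i j], then apply [c j]. *)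
Lemma cofinal_cocone_hom (Sigma : signature) (S : sequence Sigma)
    (V : algebra Sigma -> Prop) (A C : algebra Sigma)
    (alpha : forall i, hom (S i) A) (i : nat -> nat)
    (lt_i : forall n, i n < i n.+1) (c : forall n, hom (S (i n)) C) :
  is_cocone alpha ->
  (forall (C : algebra Sigma) (c : forall i, hom (S i) C), V C -> is_cocone c ->
    exists h : hom A C, (forall i, h \o alpha i =1 c i) /\
      forall h' : hom A C, (forall i, h' \o alpha i =1 c i) -> h' =1 h) ->
  V C -> (forall n, c n.+1 \o seq_trans S (ltnW (lt_i n)) =1 c n) ->
  exists h : hom A C, forall n, h \o alpha (i n) =1 c n.
Proof.
move=> alphaC alphaU VC c_step.
have ge_i n : n <= i n by elim: n => // n ih; exact: leq_ltn_trans ih (lt_i n).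
have le_i : {homo i : m n / m <= n}.
  by apply: (homo_leq leqnn leq_trans) => n; exact: ltnW.
have c_trans m n (h : m <= n) (h' : i m <= i n) : c n \o seq_trans S h' =1 c m.
  move=> x; elim: n => [|n ih] in h h' *.
    have m0 : m = 0 by apply/eqP; rewrite -leqn0.
    by subst m; rewrite /= seq_trans_refl.
  have: m <= n.+1 := h; rewrite leq_eqVlt ltnS => /orP[/eqP e|h1].
    by subst m; rewrite /= seq_trans_refl.
  rewrite -(ih h1 (le_i _ _ h1)) /= -(c_step n) /=.
  by rewrite (seq_trans_comp _ _ h').
have cC : is_cocone (fun j => comp_hom (c j) (seq_trans S (ge_i j))).
  move=> j l h x /=; rewrite -(c_trans j l h (le_i _ _ h)) /=.
  by rewrite !(seq_trans_comp _ _ (leq_trans h (ge_i l))).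
have [h [hc _]] := alphaU _ _ VC cC; exists h => n x.
(* At stage [i n] the extended cocone passes through stage [i (i n)]; as [n <= i n], the result is
   again [c n]. *)
rewrite -(c_trans n (i n) (ge_i n) (le_i _ _ (ge_i n)) x).
have := hc (i n) x; rewrite /= => ->.
by rewrite (bool_irrelevance (ge_i (i n)) (le_i _ _ (ge_i n))).
Qed.

(** The interleaving maps followed by the colimit maps are cocones on cofinal subsequences. The
    induced maps are mutually inverse on the images of these stages, which exhaust [A] and [B]. *)
Lemma confluent_isomorphic (Sigma : signature) (V : algebra Sigma -> Prop)
    (A B : algebra Sigma) (SA SB : sequence Sigma) :
  variety V -> (forall i, V (SA i)) -> (forall k, V (SB k)) ->
  is_colimit SA V A -> is_colimit SB V B ->
  confluent SA SB -> isomorphic A B.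
Proof.
move=> Vv SAV SBV [VA [alpha [alphaC alphaU]]] [VB [beta [betaC betaU]]].
case=> i [k [lt_i [lt_k [f [g fg]]]]].
have [alphaS _] := colimit_concrete Vv SAV VA alphaC alphaU.
have [betaS _] := colimit_concrete Vv SBV VB betaC betaU.
have [h hf] : exists h : hom A B, forall n,
    h \o alpha (i n) =1 comp_hom (beta (k n)) (f n).
  apply: cofinal_cocone_hom alphaC alphaU VB _ => // n x.
  have [gf_n fg_n] := fg n; rewrite /= gf_n -(betaC _ _ (ltnW (lt_k n))) /=.
  by rewrite fg_n.
have [h' hg] : exists h' : hom B A, forall n,
    h' \o beta (k n) =1 comp_hom (alpha (i n.+1)) (g n).
  apply: cofinal_cocone_hom betaC betaU VA _ => // n x.
  have [_ fg_n] := fg n; have [gf_n _] := fg n.+1.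
  by rewrite /= fg_n -(alphaC _ _ (ltnW (lt_i n.+1))) /= gf_n.
have ge_i n : n <= i n by elim: n => // n ih; exact: leq_ltn_trans ih (lt_i n).
have ge_k n : n <= k n by elim: n => // n ih; exact: leq_ltn_trans ih (lt_k n).
exists h, h'; split=> [a|b].
  (* As [N <= i N], the element [a] lifts to a stage of the subsequence. *)
  have [N hN] := alphaS a; have [x <-] := hN _ (ge_i N).
  have /= -> := hf N x; have /= -> := hg N (f N x).
  rewrite -(alphaC _ _ (ltnW (lt_i N))) /=.
  by have [-> _] := fg N.
have [N hN] := betaS b; have [x <-] := hN _ (ge_k N).
have /= -> := hg N x; have /= -> := hf N.+1 (g N x).
rewrite -(betaC _ _ (ltnW (lt_k N))) /=.
by have [_ ->] := fg N.
Qed.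

(** * Assembly of the two equivalences *)

Theorem corollary3p2 (Sigma : signature) (V : algebra Sigma -> Prop)
    (A B : algebra Sigma) (SA SB : sequence Sigma)
    (V_variety : variety V)
    (SA_in_V : forall i : nat, V (SA i))
    (SB_in_V : forall k : nat, V (SB k))
    (A_colimit : is_colimit SA V A)
    (B_colimit : is_colimit SB V B) :
  ((forall i : nat, finitely_presented V (SA i)) ->
   (forall k : nat, finitely_presented V (SB k)) ->
   (isomorphic A B <-> confluent SA SB)) /\
  ((forall i : nat, finitely_generated V (SA i)) ->
   (forall k : nat, finitely_generated V (SB k)) ->
   (forall i : nat, injective (seq_hom SA i)) ->
   (forall k : nat, injective (seq_hom SB k)) ->
   (isomorphic A B <-> confluent SA SB)).
Proof.
have conf_iso : confluent SA SB -> isomorphic A B by exact: (confluent_isomorphic V_variety SA_in_V SB_in_V).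
have [VA [alpha [alphaC alphaU]]] := A_colimit.
have [VB [beta [betaC betaU]]] := B_colimit.
have [alphaS alphaI] := colimit_concrete V_variety SA_in_V VA alphaC alphaU.
have [betaS betaI] := colimit_concrete V_variety SB_in_V VB betaC betaU.
(* Uniqueness of factorizations is proved from finite generation, so this makes it available in the
   first case too. *)
have fp_fg P : finitely_presented V P -> finitely_generated V P.
  by case=> n [theta [_ iso]]; exists n, theta.
split=> [fpA fpB|fgA fgB injA injB]; split=> // -[phi [psi [phiK psiK]]].
  apply: (back_and_forth alphaC betaC phiK psiK) => j.
  - by apply: (fg_factors_uniquely SA_in_V alphaI); exact: fp_fg.
  - by apply: (fg_factors_uniquely SB_in_V betaI); exact: fp_fg.
  - exact: (fp_factors_eventually SB_in_V VB betaC betaS betaI).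
  - exact: (fp_factors_eventually SA_in_V VA alphaC alphaS alphaI).
apply: (back_and_forth alphaC betaC phiK psiK) => j.
- exact: (fg_factors_uniquely SA_in_V alphaI).
- exact: (fg_factors_uniquely SB_in_V betaI).
- exact: (fg_factors_eventually SB_in_V VB betaS betaI).
- exact: (fg_factors_eventually SA_in_V VA alphaS alphaI).
Qed.
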